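(* Let $f\colon P\to Q$ be a closed full map of finite posets, where $P$ is nonsingular (for example, let $f$ be a simplicial map of finite simplicial complexes). Then $$P=\operatorname{hocolim}_Q\bigl(f^{-1}(q),f_{rq}\bigr),$$ where $f_{rq}\colon f^{-1}(r)\to f^{-1}(q)$ ($r>q$ in $Q$) are the Hatcher maps of $f$; that is, the order of $P$ coincides with the order of the homotopy colimit on the common underlying set $\bigsqcup_{q\in Q}f^{-1}(q)$.
   Context: For an element $p$ of a poset $P$ let $\lceil p\rceil=\lceil p\rceil_P=\{x\in P: x\le p\}$, the cone of $p$. A monotone map $f\colon P\to Q$ is closed if $f(\lceil p\rceil)=\lceil f(p)\rceil$ for every $p\in P$. A subposet $F$ of $P$ is full in $P$ if for every $p\in P$ the intersection $\lceil p\rceil_P\cap F$ is either empty or a cone $\lceil x\rceil_F$ of $F$. A monotone map $f\colon P\to Q$ is full if $f^{-1}(q)$ is full in $P$ for every $q\in Q$. A poset is nonsingular if it contains no interval $[a,b]=\{c: a\le c\le b\}$ of cardinality three. A finite simplicial complex is identified with its poset of nonempty simplices; a simplicial map is a closed monotone map between such posets (it is automatically full, and simplicial complexes are nonsingular). Hatcher maps: let $f\colon P\to Q$ be a closed full map and $F_q=f^{-1}(q)$. If $p\in P$ and $q<f(p)$, then $\lceil p\rceil_P\cap F_q=\lceil p_q\rceil_{F_q}$ for a unique $p_q\in F_q$. For $r>q$ in $Q$ the Hatcher map $f_{rq}\colon F_r\to F_q$ is the monotone map $p\mapsto p_q$ (the unique map from the empty poset if $F_r=\emptyset$). One has $f_{st}f_{rs}=f_{rt}$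 for $r>s>t$. Homotopy colimit: given a commutative diagram of posets $P_\lambda$ indexed by a poset $\Lambda$, with monotone maps $f_{\lambda\mu}\colon P_\lambda\to P_\mu$ for $\lambda>\mu$, $\operatorname{hocolim}_\Lambda(P_\lambda,f_{\lambda\mu})$ is the set $\bigsqcup_{\lambda\in\Lambda}P_\lambda$ with the following relation: for $p\in P_\lambda$ and $q\in P_\mu$, $p\ge q$ iff either $\lambda=\mu$ and $p\ge q$ in $P_\lambda$, or $\lambda>\mu$ and there exists $p'\in P_\lambda$ with $p'\le p$ in $P_\lambda$ and $f_{\lambda\mu}(p')=q$.
   Formalization: For general closed full maps, f_st f_rs = f_rt is added as a hypothesis: it can fail (P = {e<c<x, e<b<x}, e,c↦0, b↦1, x↦2), and then the claim is false and the homotopy colimit undefined; for simplicial maps it is proved. *)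

(* Defs.v *)
From HB Require Import structures.
From mathcomp Require Import all_boot all_order.

Set Implicit Arguments.
Unset Strict Implicit.
Unset Printing Implicit Defensive.

Import Order.TTheory.
Local Open Scope order_scope.

Section Posets.
Context {d : Order.disp_t} {P : finPOrderType d}.
Implicit Types (F : {set P}) (p a b : P).

Definition cone p : {set P} := [set x | x <= p].

(* The cone of p in the subposet F, when p \in F. *)
Definition cone_in F p : {set P} := [set x in F | x <= p].

Definition full_subposet F : Prop :=
  forall p, cone p :&: F = set0 \/
            exists2 x, x \in F & cone p :&: F = cone_in F x.

End Posets.

Definition nonsingular {d} (P : finPOrderType d) : Prop :=
  forall a b : P, #|[set c | a <= c <= b]| <> 3.

Section Maps.
Context {dP dQ : Order.disp_t} {P : finPOrderType dP} {Q : finPOrderType dQ}.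
Variable f : {omorphism P -> Q}.

Definition closed_map : Prop := forall p, f @: cone p = cone (f p).

Definition fiber_set (q : Q) : {set P} := [set p | f p == q].

Definition full_map : Prop := forall q, full_subposet (fiber_set q).

Definition fiber (q : Q) : Type := {p : P | p \in fiber_set q}.

HB.instance Definition _ q := SubChoice.on (fiber q).
HB.instance Definition _ q := [Finite of fiber q by <:].
HB.instance Definition _ q :=
  [SubChoice_isSubPOrder of fiber q by <: with dP].

Lemma fiberP (p : P) : p \in fiber_set (f p).
Proof. by rewrite inE. Qed.

Definition in_fiber (p : P) : {q : Q & fiber q} :=
  existT fiber (f p) (exist _ p (fiberP p)).

End Maps.

Section Hatcher.
Context {dP dQ : Order.disp_t} {P : finPOrderType dP} {Q : finPOrderType dQ}.
Context {f : {omorphism P -> Q}} (f_closed : closed_map f) (f_full : full_map f).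

Lemma hatcher_subproof (r q : Q) (ltqr : q < r) (p : fiber f r) :
  exists x : fiber f q,
    cone (val p) :&: fiber_set f q == cone_in (fiber_set f q) (val x).
Proof.
have /eqP fp : f (val p) == r by move: (valP p); rewrite inE.
have : q \in cone (f (val p)) by rewrite inE fp ltW.
rewrite -f_closed => /imsetP[y yp qy].
have yF : y \in cone (val p) :&: fiber_set f q by rewrite inE yp inE qy eqxx.
case: (f_full q (val p)) => [F0|[x xF Fx]]; first by rewrite F0 inE in yF.
by exists (exist _ x xF); rewrite Fx.
Qed.

Definition hatcher (r q : Q) (ltqr : q < r) (p : fiber f r) : fiber f q :=
  xchoose (hatcher_subproof ltqr p).

Lemma hatcherP (r q : Q) (ltqr : q < r) (p : fiber f r) (x : fiber f q) :
  cone (val p) :&: fiber_set f q = cone_in (fiber_set f q) (val x) <->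
  x = hatcher ltqr p.
Proof.
have /eqP Ep := xchooseP (hatcher_subproof ltqr p).
split=> [Ex|->//]; apply/val_inj/le_anti/andP.
have sub (u v : fiber f q) :
    cone_in (fiber_set f q) (val u) = cone_in (fiber_set f q) (val v) ->
  val u <= val v.
  move=> /setP/(_ (val u)); rewrite !inE lexx andbT.
  by have := valP u; rewrite inE => -> /esym.
by split; apply: sub; rewrite -Ex -Ep.
Qed.

Fact hatcher_monotone (r q : Q) (ltqr : q < r) :
  {homo hatcher ltqr : p p' / p <= p'}.
Proof.
move=> p p' lepp'.
have /eqP/setP Ep := xchooseP (hatcher_subproof ltqr p).
have /eqP/setP Ep' := xchooseP (hatcher_subproof ltqr p').
have hF := valP (hatcher ltqr p); rewrite inE in hF.
have := Ep (val (hatcher ltqr p)); rewrite !inE hF lexx !andbT => lehp.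
have := Ep' (val (hatcher ltqr p)).
by rewrite !inE hF (le_trans lehp lepp') => /esym.
Qed.

HB.instance Definition _ (r q : Q) (ltqr : q < r) :=
  Order.isOrderMorphism.Build dP (fiber f r) dP (fiber f q) (hatcher ltqr)
    (hatcher_monotone ltqr).

(* This does not follow from the hypotheses that f is closed and full and that
   P is nonsingular.  Let P consist of the four elements e < c < x and
   e < b < x, with b and c incomparable, and let f map e and c to 0, b to 1
   and x to 2, in the chain 0 < 1 < 2; then x_0 = c but (x_1)_0 = b_0 = e.
   Hence x >= e, although no x' <= x in the fiber of 2 has x'_0 = e. *)
Definition hatcher_commutes : Prop :=
  forall (r s t : Q) (ltsr : s < r) (ltts : t < s) (lttr : t < r)
    (p : fiber f r), hatcher ltts (hatcher ltsr p) = hatcher lttr p.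

End Hatcher.

Record poset_diagram {dL : Order.disp_t} (L : porderType dL)
    (d : Order.disp_t) := PosetDiagram {
  diag_obj : L -> porderType d;
  diag_map : forall l m : L, m < l -> {omorphism diag_obj l -> diag_obj m};
  diag_comp : forall (l m n : L) (ltml : m < l) (ltnm : n < m) (ltnl : n < l)
    (x : diag_obj l),
    diag_map ltnm (diag_map ltml x) = diag_map ltnl x
}.

Definition hocolim {dL : Order.disp_t} (L : porderType dL) (d : Order.disp_t)
    (D : poset_diagram L d) : Type := {l : L & diag_obj D l}.

(* hocolim_le y x is x >= y.  The relation need not be transitive for an
   arbitrary diagram of monotone maps, so it is not packaged as an order. *)
Definition hocolim_le {dL : Order.disp_t} {L : porderType dL}
    {d : Order.disp_t} (D : poset_diagram L d) (y x : hocolim D) : Prop :=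
  (exists (l : L) (a b : diag_obj D l),
     [/\ y = existT _ l a, x = existT _ l b & a <= b]) \/
  (exists (ltyx : projT1 y < projT1 x),
   exists2 x' : diag_obj D (projT1 x),
     x' <= projT2 x & diag_map D ltyx x' = projT2 y).

Section HatcherDiagram.
Context {dP dQ : Order.disp_t} {P : finPOrderType dP} {Q : finPOrderType dQ}.
Context {f : {omorphism P -> Q}} (f_closed : closed_map f) (f_full : full_map f).

Definition hatcher_diagram (f_comm : hatcher_commutes f_closed f_full) :
    poset_diagram Q dP :=
  @PosetDiagram dQ Q dP (fun q => fiber f q)
    (fun r q (ltqr : q < r) => hatcher f_closed f_full ltqr) f_comm.

(* P = hocolim D, along p |-> (f p, p). *)
Definition order_is_hocolim (f_comm : hatcher_commutes f_closed f_full) : Prop :=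
  bijective (in_fiber f : P -> hocolim (hatcher_diagram f_comm)) /\
  forall p q : P, (q <= p) <->
    @hocolim_le _ _ _ (hatcher_diagram f_comm) (in_fiber f q) (in_fiber f p).

End HatcherDiagram.

Record simplicial_complex (V : finType) := SimplicialComplex {
  simplices : {set {set V}};
  simplices_neq0 : set0 \notin simplices;
  simplices_sub : forall s t : {set V},
    s \in simplices -> t \subset s -> t != set0 -> t \in simplices
}.

Section FacePoset.
(* {set V} ordered by inclusion. *)
Import Order.DefaultSetSubsetOrder.
Context {V : finType} (K : simplicial_complex V).

Definition simplex : Type := {s : {set V} | s \in simplices K}.

HB.instance Definition _ := SubChoice.on simplex.
HB.instance Definition _ := [Finite of simplex by <:].
HB.instance Definition _ :=
  [SubChoice_isSubPOrder of simplex by <: with Order.SetSubsetOrder.subset_display].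

End FacePoset.

Lemma le_simplexE (V : finType) (K : simplicial_complex V) (s t : simplex K) :
  (s <= t) = (val s \subset val t).
Proof. by []. Qed.

(* Main.v *)
Require Import Defs.
From mathcomp Require Import all_boot all_order.

Import Order.TTheory.
Local Open Scope order_scope.

Set Implicit Arguments.
Unset Strict Implicit.
Unset Printing Implicit Defensive.

(** The order of [P] is compared with that of the homotopy colimit fiber by
    fiber.  For [u < r] the Hatcher map sends [p] to the greatest element of
    the fiber over [u] below [p], so [q <= p_u] iff [q <= p]; hence a relation
    of the homotopy colimit holds in [P].  The converse says that Hatcher maps
    lift: if [q <= p] lie over [u < r], then some [p' <= p] over [r] has
    [p'_u = q].

    When [r] covers [u], let [p'] be minimal over [r] with [q <= p' <= p].  If
    [q < p'_u], choose [q1 >= q] covered by [p'_u] in the fiber over [u].  An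
    element between [q1] and [p'] lies over [u] or over [r]; in the first case
    it is at most [p'_u], hence is [q1] or [p'_u], and in the second it equals
    [p'] by minimality.  So the interval is the three-element set of [q1],
    [p'_u] and [p'], against nonsingularity
    ([lift_cover]).  When [u < t < r], one lifts [q] to an element below [p_t]
    over [t], and that element to one below [p] over [r]; the two Hatcher maps
    compose, so induction on the open interval from [u] to [r] concludes
    ([lift]).

    In the simplicial case everything follows from the fact that [f c <= q]
    can be tested on the vertices of [c] ([le_image_vertices]): faces of a
    simplex with image [q] are closed under unions, which gives fullness, and
    the largest face over [s] contains the largest face over any [t < s],
    which gives commutation of the Hatcher maps.  An interval [a < c < b] of
    simplices also contains the union of [a] and [b \ c], which is none of the
    three. *)

(** * Extremal elements *)

Lemma exists_minimal d (T : finPOrderType d) (A : pred T) (x : T) : A x ->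
  exists m, [/\ m <= x, A m & forall y, A y -> y <= m -> y = m].
Proof.
move=> Ax.
have Px : A x && (x <= x) by rewrite Ax lexx.
case: (@arg_minnP T x (fun y => A y && (y <= x)) (fun y => #|cone y|) Px).
move=> m /andP[Am lemx] minm; exists m; split=> // y Ay leym.
have := minm y; rewrite Ay (le_trans leym lemx) => /(_ isT) lecard.
have : cone y == cone m.
  rewrite eqEcard lecard andbT; apply/subsetP=> z; rewrite !inE => lezy.
  exact: le_trans lezy leym.
move/eqP/setP/(_ m); rewrite !inE lexx => lemy.
by apply/le_anti; rewrite leym lemy.
Qed.

Lemma exists_lower_cover d (T : finPOrderType d) (a b : T) : a < b ->
  exists c, [/\ a <= c, c < b & forall x, c <= x -> x < b -> x = c].
Proof.
move=> ltab.
have [c [leac ltcb maxc]] :=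
  @exists_minimal _ T^d (fun x => (x : T) < b) a ltab.
by exists c; split=> // x lecx ltxb; apply: maxc.
Qed.

(** * Hatcher maps *)

Section Hatcher.
Context {dP dQ : Order.disp_t} {P : finPOrderType dP} {Q : finPOrderType dQ}.
Context {f : {omorphism P -> Q}}.

Lemma fiber_val q (p : fiber f q) : f (val p) = q.
Proof. by have := valP p; rewrite inE => /eqP. Qed.

Definition Fiber {q p} (fp : f p = q) : fiber f q :=
  exist _ p (etrans (in_set _ p) (introT eqP fp)).

Lemma in_fiberE q (a : fiber f q) : in_fiber f (val a) = existT _ q a.
Proof.
case: a => p pq; have E : f p = q by move: pq; rewrite inE => /eqP.
by subst q; congr existT; apply: val_inj.
Qed.

Context (f_closed : closed_map f) (f_full : full_map f).

(** The defining property of [p_u] as an adjunction: it is the greatest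
    element below [p] in the fiber over [u]. *)
Lemma le_hatcher {r u} (ltur : u < r) (p : fiber f r) (q : fiber f u) :
  (q <= hatcher f_closed f_full ltur p) = (val q <= val p).
Proof.
have /(hatcherP f_closed f_full ltur)/setP/(_ (val q)) :=
  erefl (hatcher f_closed f_full ltur p).
by rewrite !inE fiber_val eqxx andbT.
Qed.

Lemma hatcher_le {r u} (ltur : u < r) (p : fiber f r) :
  val (hatcher f_closed f_full ltur p) <= val p.
Proof. by rewrite -le_hatcher. Qed.

Hypothesis nsP : nonsingular P.

(** Otherwise an interval of cardinality three appears: the top is a minimal
    candidate [m] for the lift, the middle its image [s] under the Hatcher map,
    and the bottom an element [q1 >= q] that [s] covers in its fiber. *)
Lemma lift_cover {r u} (ltur : u < r) (p : fiber f r) (q : fiber f u) :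
  (forall t, u < t -> t < r -> False) -> val q <= val p ->
  exists2 p' : fiber f r, p' <= p & hatcher f_closed f_full ltur p' = q.
Proof.
move=> cov leqp.
have [m [lemp leqm minm]] :=
  @exists_minimal _ (fiber f r) (fun x => val q <= val x) p leqp.
exists m => //; set s := hatcher _ _ _ m.
have leqs : q <= s by rewrite le_hatcher.
have [//|neq_sq] := eqVneq s q.
have {leqs neq_sq} ltqs : q < s by rewrite lt_neqAle eq_sym neq_sq.
have [q1 [leqq1 ltq1s covq1]] := exists_lower_cover ltqs.
case: (@nsP (val q1) (val m)).
have lt1s : val q1 < val s by [].
have ltsm : val s < val m.
  rewrite lt_neqAle hatcher_le andbT; apply/eqP=> E.
  by move: (ltur); rewrite -(fiber_val s) -(fiber_val m) E ltxx.
have -> : [set c | val q1 <= c <= val m] = [set val q1; val s; val m].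
  apply/setP=> c; rewrite !inE; apply/idP/idP; last first.
    have leq1s := ltW lt1s; have lesm := ltW ltsm.
    by case/orP=> [/orP[]|] /eqP->;
      rewrite ?lexx ?leq1s ?lesm ?(le_trans leq1s lesm).
  case/andP=> le1c lecm.
  have leuc : u <= f c by rewrite -(fiber_val q1) omorph_le.
  have lecr : f c <= r by rewrite -(fiber_val m) omorph_le.
  have [fcu|neq_cu] := eqVneq (f c) u.
    have lecs : Fiber fcu <= s by rewrite le_hatcher.
    have [<-|neq_cs] := eqVneq (Fiber fcu) s; first by rewrite eqxx orbT.
    suff <- : Fiber fcu = q1 by rewrite eqxx.
    by apply: covq1 => //; rewrite lt_neqAle neq_cs.
  have [fcr|neq_cr] := eqVneq (f c) r.
    suff <- : Fiber fcr = m by rewrite eqxx orbT.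
    by apply: minm => //; apply: le_trans le1c.
  by case: (cov (f c)); rewrite lt_neqAle ?leuc ?lecr ?neq_cr // eq_sym neq_cu.
by rewrite setUC cardsU1 cards2 !inE (gt_eqF ltsm)
  (gt_eqF (lt_trans lt1s ltsm)) (lt_eqF lt1s).
Qed.

Hypothesis f_comm : hatcher_commutes f_closed f_full.

(** Since [q <= p_t] by commutation of the Hatcher maps, [q] can be lifted to
    the fiber over [t] first. *)
Lemma lift {r u} (ltur : u < r) (p : fiber f r) (q : fiber f u) :
  val q <= val p ->
  exists2 p' : fiber f r, p' <= p & hatcher f_closed f_full ltur p' = q.
Proof.
have [n] := ubnP #|[set t | u < t < r]|.
elim: n => // n IHn in r u ltur p q *; rewrite ltnS => len leqp.
case: (pickP (fun t => u < t < r)) => [t /andP[ltut lttr]|cov]; last first.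
  by apply: lift_cover => // t ltut lttr; have := cov t; rewrite ltut lttr.
have tI : t \in [set x | u < x < r] by rewrite inE ltut.
have smaller (B : {set Q}) :
    {subset B <= [set x | u < x < r]} -> t \notin B -> (#|B| < n)%N.
  move=> sBI tB; apply: leq_trans len; apply: proper_card; apply/properP.
  by split; [apply/subsetP | exists t].
have leqpt : val q <= val (hatcher f_closed f_full lttr p).
  by rewrite -(le_hatcher ltut) (f_comm lttr ltut ltur) le_hatcher.
have [|x lexpt xq] := IHn _ _ ltut _ _ _ leqpt.
  apply: smaller => [y|]; rewrite !inE ?ltxx ?andbF // => /andP[-> ltyt].
  exact: lt_trans ltyt lttr.
have [||p' lep'p p'x] := IHn _ _ lttr p x.
- apply: smaller => [y|]; rewrite !inE ?ltxx // => /andP[ltty ->].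
  by rewrite (lt_trans ltut ltty).
- by rewrite -(le_hatcher lttr).
by exists p' => //; rewrite -(f_comm lttr ltut ltur) p'x.
Qed.

Lemma nonsingular_hocolim : order_is_hocolim f_comm.
Proof.
pose point (x : {q : Q & fiber f q}) : P := val (projT2 x).
split; first by exists point => [//|[r a]]; apply: in_fiberE.
move=> p q; split=> [leqp|].
  have [eqf|neqf] := eqVneq (f q) (f p).
    left; exists (f p), (Fiber eqf), (Fiber (erefl (f p))).
    by split=> //; rewrite -in_fiberE.
  have ltqp : f q < f p by rewrite lt_neqAle neqf omorph_le.
  right; exists ltqp.
  have [|p' lep'p p'q] := @lift _ _ ltqp (Fiber erefl) (Fiber erefl) _ => //.
  exists p'; first exact: lep'p.
  by rewrite /= p'q; apply: val_inj.
case=> [[l [a [b [qa pb leab]]]]|[ltqp [p' lep'p p'q]]].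
  have -> : q = val a by move: qa => /(congr1 point).
  by have -> : p = val b by move: pb => /(congr1 point).
have : val p' <= p := lep'p.
by apply: le_trans; have := hatcher_le ltqp p'; rewrite [hatcher _ _ _ _]p'q.
Qed.
End Hatcher.

(** * Simplicial maps *)

Section Simplices.
Context {V : finType} {K : simplicial_complex V}.
Implicit Types a b c : simplex K.

Lemma val_simplex_neq0 a : val a != set0.
Proof.
by apply: contraTneq (valP a) => ->; apply: simplices_neq0.
Qed.

Lemma exists_simplex a (s : {set V}) :
  s \subset val a -> s != set0 -> exists b, val b = s.
Proof.
move=> sa s0; have sK := simplices_sub (valP a) sa s0.
by exists (exist _ s sK).
Qed.

Lemma exists_vertex a v : v \in val a -> exists b, val b = [set v].
Proof.
move=> va; apply: (@exists_simplex a); first by rewrite sub1set.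
by apply/set0Pn; exists v; rewrite inE.
Qed.

Lemma exists_union a b p : a <= p -> b <= p ->
  exists c, [/\ val c = val a :|: val b, c <= p, a <= c & b <= c].
Proof.
move=> leap lebp.
have subp : val a :|: val b \subset val p by rewrite subUset; apply/andP.
have [|c valc] := exists_simplex subp.
  by rewrite -subset0 subUset negb_and subset0 val_simplex_neq0.
by exists c; split=> //; rewrite le_simplexE valc ?subsetUl ?subsetUr //.
Qed.

(** If [a < c < b], then [d], the union of [a] and [b \ c], contains a vertex
    [v] of [b \ c] and misses a vertex [w] of [c \ a], so it is a fourth
    element of the interval. *)
Lemma simplex_nonsingular : nonsingular (simplex K).
Proof.
move=> a b; set I := [set _ | _] => cardI.
have /set0Pn[c] : I :\: [set a; b] != set0.
  rewrite -card_gt0 cardsD cardI subn_gt0.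
  apply: leq_ltn_trans (subset_leq_card (subsetIr _ _)) _.
  by rewrite cards2; case: eqP.
rewrite !inE negb_or => /and3P[/andP[neqca neqcb] leac lecb].
have leab := le_trans leac lecb.
have /properP[_ [v vb vNc]] : val c \proper val b.
  by rewrite properEneq (inj_eq val_inj) neqcb.
have /properP[_ [w wc wNa]] : val a \proper val c.
  by rewrite properEneq eq_sym (inj_eq val_inj) neqca.
have vNa : v \notin val a by apply: contra vNc; apply: (subsetP leac).
have wb : w \in val b by apply: (subsetP lecb).
have db : val a :|: (val b :\: val c) \subset val b.
  by rewrite subUset subsetDl andbT.
have [|d vald] := exists_simplex db.
  by apply/set0Pn; exists v; rewrite !inE vNc vb orbT.
have vd : v \in val d by rewrite vald !inE vNc vb orbT.
have wNd : w \notin val d by rewrite vald !inE (negPf wNa) wc.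
have neqab : a != b by apply: contraNneq vNa => ->.
have neqda : d != a by apply: contraTneq vd => ->.
have neqdc : d != c by apply: contraTneq vd => ->.
have neqdb : d != b by apply: contraNneq wNd => ->.
have : [set d; c; a; b] \subset I.
  apply/subsetP=> x; rewrite !inE -!orbA => /or4P[] /eqP->.
  - by rewrite !le_simplexE vald subsetUl.
  - by rewrite leac.
  - by rewrite lexx.
  by rewrite leab lexx.
move/subset_leq_card; rewrite cardI -!setUA !cardsU1 cards1 !inE.
by rewrite !negb_or neqdc neqda neqdb neqca neqcb neqab.
Qed.
End Simplices.

Section SimplicialMap.
Context {V W : finType} {K : simplicial_complex V} {L : simplicial_complex W}.
Context {f : {omorphism simplex K -> simplex L}} (f_closed : closed_map f).

(** A vertex [w] of [f c] is, by closedness, the image of a face [y] of [c];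
    any vertex [v] of [y] has image exactly [w], and [v] lies in some [a] with
    [f a <= q], so [w] lies in [q]. *)
Lemma le_image_vertices (c : simplex K) (q : simplex L) :
  (forall v, v \in val c -> exists2 a : simplex K, v \in val a & f a <= q) ->
  f c <= q.
Proof.
move=> cq; rewrite le_simplexE; apply/subsetP=> w wfc.
have [w' valw'] := exists_vertex wfc.
have : w' \in cone (f c) by rewrite inE le_simplexE valw' sub1set.
rewrite -f_closed => /imsetP[y]; rewrite inE => leyc w'y.
have /set0Pn[v vy] := val_simplex_neq0 y.
have [v' valv'] := exists_vertex vy.
have : f v' <= w' by rewrite w'y omorph_le // le_simplexE valv' sub1set.
have /set0Pn[x xv'] := val_simplex_neq0 (f v').
rewrite le_simplexE valw' => /subsetP/(_ _ xv'); rewrite inE => /eqP xw.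
have [|a va leaq] := cq v; first exact: (subsetP leyc).
apply: (subsetP leaq); rewrite -xw.
have : f v' <= f a by rewrite omorph_le // le_simplexE valv' sub1set.
by move/subsetP; apply.
Qed.

(** The union of all faces of [p] with image [q] again has image [q]. *)
Lemma simplicial_full : full_map f.
Proof.
move=> q p; pose A := cone p :&: fiber_set f q.
have [A0|/set0Pn[a aA]] := eqVneq A set0; [by left | right].
have AP b : b \in A -> b <= p /\ f b = q by rewrite !inE => /andP[-> /eqP].
have [leap faq] := AP a aA.
have subp : \bigcup_(b in A) val b \subset val p.
  by apply/bigcupsP=> b /AP[].
have leU b : b \in A -> val b \subset \bigcup_(b in A) val b.
  by move=> bA; apply: bigcup_sup.
have [|x valx] := exists_simplex subp.
  have /set0Pn[v va] := val_simplex_neq0 a.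
  by apply/set0Pn; exists v; apply: (subsetP (leU a aA)).
have fx : f x = q.
  apply/le_anti/andP; split.
    apply: le_image_vertices => v; rewrite valx => /bigcupP[b /AP[_ fb] vb].
    by exists b; rewrite ?fb.
  by rewrite -faq omorph_le // le_simplexE valx leU.
exists x; first by rewrite inE fx.
apply/setP=> y; rewrite !inE andbC; apply/andP/andP=> [] [fy ley]; split=> //.
  by rewrite le_simplexE valx leU // !inE ley.
by apply: le_trans ley _; rewrite le_simplexE valx.
Qed.

(** The union of [p_t] and [p_s] has image [s], hence is [p_s]; so
    [p_t <= p_s] and [p_t <= (p_s)_t]. *)
Lemma simplicial_hatcher_commutes (f_full : full_map f) :
  hatcher_commutes f_closed f_full.
Proof.
move=> r s t ltsr ltts lttr p; apply/le_anti/andP; split.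
  by rewrite le_hatcher; do 2!apply: le_trans (hatcher_le _ _ _ _) _.
rewrite le_hatcher.
set a := hatcher _ _ lttr p; set b := hatcher _ _ ltsr p.
have [c [valc lecp leac lebc]] :=
  exists_union (hatcher_le _ _ lttr p) (hatcher_le _ _ ltsr p).
have fc : f c = s.
  apply/le_anti/andP; split.
    apply: le_image_vertices => v; rewrite valc in_setU => /orP[va|vb].
      by exists (val a); rewrite ?fiber_val ?ltW.
    by exists (val b); rewrite ?fiber_val.
  by rewrite -(fiber_val b) omorph_le.
have lecb : Fiber fc <= b by rewrite le_hatcher.
exact: le_trans leac lecb.
Qed.
End SimplicialMap.

Theorem theorem9p8 :
  (forall (dP dQ : Order.disp_t)
     (P : finPOrderType dP) (Q : finPOrderType dQ) (f : {omorphism P -> Q})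
     (f_closed : closed_map f) (f_full : full_map f)
     (f_comm : hatcher_commutes f_closed f_full),
     nonsingular P -> order_is_hocolim f_comm)
  /\
  (forall (V W : finType) (K : simplicial_complex V) (L : simplicial_complex W)
     (f : {omorphism simplex K -> simplex L}) (f_closed : closed_map f),
     nonsingular (simplex K) /\
     exists (f_full : full_map f) (f_comm : hatcher_commutes f_closed f_full),
       order_is_hocolim f_comm).
Proof.
split=> [dP dQ P Q f f_closed f_full f_comm nsP|V W K L f f_closed].
  exact: nonsingular_hocolim.
split; first exact: simplex_nonsingular.
have f_full := simplicial_full f_closed.
exists f_full, (simplicial_hatcher_commutes f_closed f_full).
exact/nonsingular_hocolim/simplex_nonsingular.
Qed.
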